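(* For every positive integer $n$, $$a(n)=\sum_{r=1}^\infty(-1)^{T_{r-1}}\,T_{\lceil r/2\rceil}\,\mathrm{pod}\left(n-T_{r+1}\right).$$
   Context: For a positive integer $n$, $a(n)$ is the signed number of partitions of $n$ into exactly two distinct part sizes, each occurring an odd number of times: $$a(n)=\sum (-1)^{r_1+r_2},$$ the sum being over all quadruples of integers $(x,y,r_1,r_2)$ with $1\le x<y$, $r_1,r_2\ge 0$ and $(2r_1+1)x+(2r_2+1)y=n$. $T_n=n(n+1)/2$ denotes the $n$-th triangular number. For $n\ge0$, $\mathrm{pod}(n)$ is the number of partitions of $n$ in which odd parts are distinct (even parts are unrestricted), so $\mathrm{pod}(0)=1$; and $\mathrm{pod}(m)=0$ for $m<0$, so the sum is finite. *)

(* Defs.v *)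
From mathcomp Require Import all_boot all_order all_algebra.
From mathcomp Require Import classical_sets fsbigop.

Set Implicit Arguments.
Unset Strict Implicit.
Unset Printing Implicit Defensive.

Local Open Scope ring_scope.

Definition tri (n : nat) : nat := ((n * n.+1) %/ 2)%N.

(* Every solution of the equation has x, y, r1, r2 <= n, so letting
   the four variables range over 'I_n.+1 loses no quadruple. *)
Definition asign (n : nat) : int :=
  \sum_(x < n.+1) \sum_(y < n.+1) \sum_(r1 < n.+1) \sum_(r2 < n.+1
      | [&& 1 <= x, x < y & (2 * r1 + 1) * x + (2 * r2 + 1) * y == n]%N)
    (-1) ^+ (r1 + r2)%N.

(* A partition of n is encoded by its multiplicities: the part i.+1 occurs
   m i times. Parts and multiplicities are at most n. *)
Definition is_partition (n : nat) (m : {ffun 'I_n -> 'I_n.+1}) : bool :=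
  (\sum_(i < n) m i * i.+1 == n)%N.

Definition pod_nat (n : nat) : nat :=
  #|[set m : {ffun 'I_n -> 'I_n.+1}
      | is_partition m & [forall i : 'I_n, odd i.+1 ==> (m i <= 1)%N]]|.

Definition pod (k : int) : nat := if k is Posz n then pod_nat n else 0%N.

(* Main.v *)
Require Import Defs.
From mathcomp Require Import all_boot all_order all_algebra.
From mathcomp Require Import classical_sets fsbigop.
From mathcomp Require Import ring zify.

Set Implicit Arguments.
Unset Strict Implicit.
Unset Printing Implicit Defensive.

(** With [f x = q^x / (1 + q^(2x))], the generating function of [asign] is the
    second elementary symmetric function of the [f x], that is, the coefficient
    of [z^2] in
    [prod_x (1 + z f x) = prod_x (1 + z q^x + q^(2x)) / (1 + q^(2x))].
    For [z = t + 1/t] the numerator is [prod_x (1 + t q^x) (1 + q^x / t)], so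
    Jacobi's triple product expands it as
    [prod_x (1 - q^x)^-1 * sum_n q^(T_n) W_n(z)], where
    [W_n = z W_(n-1) - W_(n-2)], [W_0 = 1], [W_1 = z - 1]; and
    [prod_x (1 - q^x) (1 + q^(2x))] is the inverse of the generating function
    of [pod].  Reading off the coefficient of [z^2] in [W_n] gives the formula.
    Instead of power series we use polynomials modulo [q^(n+1)] and the finite
    form of the triple product, with Gaussian binomials. *)

Import GRing.Theory.
Local Open Scope ring_scope.

(** * Congruences in a commutative ring, then modulo powers of [q] *)

Section Congruence.
Variables (A : comNzRingType) (m : A).
Implicit Types a b c d : A.

Definition eqmod a b := exists r, a = b + m * r.

Lemma eqmod_refl a : eqmod a a.
Proof. by exists 0; rewrite mulr0 addr0. Qed.

Lemma eqmod_sym a b : eqmod a b -> eqmod b a.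
Proof. by move=> [r ->]; exists (- r); ring. Qed.

Lemma eqmod_trans b a c : eqmod a b -> eqmod b c -> eqmod a c.
Proof. by move=> [r ->] [s ->]; exists (r + s); ring. Qed.

Lemma eqmodD a b c d : eqmod a b -> eqmod c d -> eqmod (a + c) (b + d).
Proof. by move=> [r ->] [s ->]; exists (r + s); ring. Qed.

Lemma eqmodM a b c d : eqmod a b -> eqmod c d -> eqmod (a * c) (b * d).
Proof.
by move=> [r ->] [s ->]; exists (r * d + b * s + m * r * s); ring.
Qed.

Lemma eqmod_sum (I : Type) (s : seq I) (P : pred I) (F G : I -> A) :
  (forall i, P i -> eqmod (F i) (G i)) ->
  eqmod (\sum_(i <- s | P i) F i) (\sum_(i <- s | P i) G i).
Proof.
move=> FG; elim/big_ind2: _ => //; first exact: eqmod_refl.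
by move=> *; apply: eqmodD.
Qed.

Lemma eqmod_prod (I : Type) (s : seq I) (P : pred I) (F G : I -> A) :
  (forall i, P i -> eqmod (F i) (G i)) ->
  eqmod (\prod_(i <- s | P i) F i) (\prod_(i <- s | P i) G i).
Proof.
move=> FG; elim/big_ind2: _ => //; first exact: eqmod_refl.
by move=> *; apply: eqmodM.
Qed.

Lemma eqmod_inv_cancel u v a b :
  eqmod (v * u) 1 -> eqmod (u * a) (u * b) -> eqmod a b.
Proof.
move=> vu ab.
have cancel_uv c : eqmod (v * (u * c)) c.
  rewrite mulrA -[X in eqmod _ X]mul1r.
  by apply: eqmodM => //; apply: eqmod_refl.
apply: (eqmod_trans (eqmod_sym (cancel_uv a))).
by apply: eqmod_trans (cancel_uv b); apply: eqmodM => //; apply: eqmod_refl.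
Qed.

Lemma eqmod_prod_widen (F : nat -> A) k n :
  (k <= n)%N -> (forall i, (k <= i < n)%N -> eqmod (F i) 1) ->
  eqmod (\prod_(i < n) F i) (\prod_(i < k) F i).
Proof.
move=> le_kn F1; rewrite -!(big_mkord xpredT) (big_cat_nat (leq0n k) le_kn) /=.
rewrite -[X in eqmod _ X]mulr1; apply: eqmodM; first exact: eqmod_refl.
rewrite big_nat_cond.
apply: (eqmod_trans (b := \prod_(k <= i < n | (k <= i < n)%N && true) 1)).
  by apply: eqmod_prod => i; rewrite andbT; apply: F1.
by rewrite big1 //; apply: eqmod_refl.
Qed.

End Congruence.

Lemma eqmod_coef (R : comNzRingType) (m : R) (p r : {poly R}) i :
  eqmod m%:P p r -> eqmod m p`_i r`_i.
Proof. by move=> [s ->]; exists s`_i; rewrite coefD coefCM. Qed.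

Lemma coef_eqmodXn (R : comNzRingType) n (p r : {poly R}) i :
  (i < n)%N -> eqmod 'X^n p r -> p`_i = r`_i.
Proof. by move=> lt_in [s ->]; rewrite coefD coefXnM lt_in addr0. Qed.

Local Notation Zq := {poly int}.

Lemma eqmodXn_add n k (p r : Zq) : (n <= k)%N -> eqmod 'X^n (p + 'X^k * r) p.
Proof.
by move=> le_nk; exists ('X^(k - n) * r); rewrite mulrA -exprD subnKC.
Qed.

Lemma eqmodXnW n k (p r : Zq) :
  (n <= k)%N -> eqmod 'X^k p r -> eqmod 'X^n p r.
Proof. by move=> le_nk [s ->]; apply: eqmodXn_add. Qed.

Lemma eqmodXn_1sub n k : (n <= k)%N -> eqmod 'X^n (1 - 'X^k : Zq) 1.
Proof. by move=> le_nk; rewrite -mulrN1; apply: eqmodXn_add. Qed.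

(** With [u = 1 + 'X * w], the geometric series in [- ('X * w)] inverts [u]; its first [n] terms
    leave an error divisible by ['X^n]. *)
Lemma eqmodXn_inv n (u : Zq) : eqmod 'X u 1 -> exists v, eqmod 'X^n (v * u) 1.
Proof.
move=> [w ->]; exists (\sum_(i < n) (- ('X * w)) ^+ i); exists (- (- w) ^+ n).
have := subrX1 (- ('X * w)) n; rewrite -mulrN exprMn => eX.
have ->: 'X^n * - (- w) ^+ n = - ('X^n * (- w) ^+ n - 1) - 1 by ring.
by rewrite eX; ring.
Qed.

Lemma eqmodXn_cancel n (u a b : Zq) :
  eqmod 'X u 1 -> eqmod 'X^n (u * a) (u * b) -> eqmod 'X^n a b.
Proof. by move=> /(eqmodXn_inv n)[v vu]; apply: eqmod_inv_cancel vu. Qed.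

(** * Gaussian binomials and the finite triple product *)

Definition qfact n : Zq := \prod_(i < n) (1 - 'X^(i.+1)).

Lemma qfactS n : qfact n.+1 = qfact n * (1 - 'X^(n.+1)).
Proof. exact: big_ord_recr. Qed.

Lemma qfact_unit n : eqmod 'X (qfact n) 1.
Proof.
have -> : 1 = \prod_(i < 0) (1 - 'X^(i.+1)) :> Zq by rewrite big_ord0.
apply: (eqmod_prod_widen (F := fun i => 1 - 'X^(i.+1))) => // i _.
exact: (@eqmodXn_1sub 1).
Qed.

Lemma qfact_neq0 n : qfact n != 0.
Proof.
apply/eqP => q0; have /(@coef_eqmodXn _ 1 _ _ 0 isT) := qfact_unit n.
by rewrite q0 coef0 coef1.
Qed.

Lemma qfact_widen k n : (k <= n)%N -> eqmod 'X^(k.+1) (qfact n) (qfact k).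
Proof.
move=> le_kn; apply: (eqmod_prod_widen (F := fun i => 1 - 'X^(i.+1))) => // i.
by case/andP=> le_ki _; apply: eqmodXn_1sub.
Qed.

Fixpoint qbin n k : Zq :=
  match n, k with
  | _, 0 => 1
  | 0, _.+1 => 0
  | n'.+1, k'.+1 => qbin n' k' + 'X^k * qbin n' k
  end.

Lemma qbin0 n : qbin n 0 = 1.
Proof. by case: n. Qed.

Lemma qbinS n k : qbin n.+1 k.+1 = qbin n k + 'X^(k.+1) * qbin n k.+1.
Proof. by []. Qed.

Lemma qbin_small n k : (n < k)%N -> qbin n k = 0.
Proof.
elim: n k => [|n IHn] [|k] //= lt_nk.
by rewrite !IHn ?mulr0 ?addr0 // ltnW.
Qed.

(** In the induction the two Pascal terms combine by [(1 - q^(k+1)) + q^(k+1) (1 - q^(l+1)) = 1 -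
    q^(k+l+2)]. *)
Lemma qbin_fact k l : qbin (k + l) k * (qfact k * qfact l) = qfact (k + l).
Proof.
have [n] := ubnP (k + l); elim: n k l => // n IHn [|k] [|l] lt_kl.
- by rewrite qbin0 /qfact !big_ord0 !mulr1.
- by rewrite qbin0 /qfact big_ord0 !mul1r.
- rewrite addn0 qbinS (qbin_small (ltnSn k)).
  have := IHn k 0%N; rewrite !addn0 => IH.
  by rewrite [in RHS]qfactS -[in RHS]IH; [rewrite qfactS; ring | lia].
rewrite addSn qbinS mulrDl.
have := IHn k l.+1; have := IHn k.+1 l; rewrite addSnnS => IH1 IH2.
rewrite [in X in X + _]qfactS.
have ->: qbin (k + l.+1) k * (qfact k * (1 - 'X^(k.+1)) * qfact l.+1) =
  qfact (k + l.+1) * (1 - 'X^(k.+1)) by rewrite -IH2; [ring | lia].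
have ->: 'X^(k.+1) * qbin (k + l.+1) k.+1 * (qfact k.+1 * qfact l.+1) =
  'X^(k.+1) * qfact (k + l.+1) * (1 - 'X^(l.+1)).
  by rewrite -IH1 ?[qfact l.+1]qfactS; [ring | lia].
rewrite qfactS; have ->: (k + l.+1).+1 = (k.+1 + l.+1)%N by lia.
by rewrite exprD; ring.
Qed.

Lemma qbin_sym k l : qbin (k + l) k = qbin (k + l) l.
Proof.
apply: (mulIf (mulf_neq0 (qfact_neq0 k) (qfact_neq0 l))).
by rewrite qbin_fact addnC [qfact k * _]mulrC qbin_fact.
Qed.

(** Symmetry turns the defining Pascal rule into its mirror form. *)
Lemma qbinS_sym n k :
  (k <= n)%N -> qbin n.+1 k.+1 = 'X^(n - k) * qbin n k + qbin n k.+1.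
Proof.
rewrite leq_eqVlt => /predU1P[->|lt_kn].
  by rewrite qbinS subnn mul1r (qbin_small (ltnSn n)) mulr0.
have [l ->] : exists l, n = (k + l.+1)%N by exists (n - k).-1; lia.
rewrite addKn; have ->: (k + l.+1).+1 = (k.+1 + l.+1)%N by lia.
rewrite qbin_sym addSn qbinS -[(k + l.+1)%N in RHS]addSnnS.
by rewrite [qbin _ k.+1]qbin_sym addSnnS [qbin _ k]qbin_sym addrC.
Qed.

Lemma tri0 : tri 0 = 0%N. Proof. by []. Qed.

Lemma triS n : tri n.+1 = (tri n + n.+1)%N.
Proof.
rewrite /tri; have ->: (n.+1 * n.+2 = n.+1 * 2 + n * n.+1)%N by lia.
by rewrite divnMDl // addnC.
Qed.

(* The value at [z = t + 1/t] is [\sum_(-n <= j <= n) (-1)^(n - j) t^j]. *)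
Fixpoint altW n : {poly Zq} :=
  match n with
  | 0 => 1
  | n'.+1 => if n' is n''.+1 then 'X * altW n' - altW n'' else 'X - 1
  end.

Lemma altWSS n : altW n.+2 = 'X * altW n.+1 - altW n. Proof. by []. Qed.

(** Since [(1 + 1/t) W_n = t^n + t^(-n-1)], this is the coefficient of [t^n] in [(1 + 1/t) prod_(1
    <= i <= N) (1 + t q^i) (1 + q^i / t)], which has [2N + 1] factors. *)
Definition tcoef N n : Zq := 'X^(tri n) * qbin N.*2.+1 (N.+1 + n).

Lemma tcoef_small N n : (N < n)%N -> tcoef N n = 0.
Proof. by move=> lt_Nn; rewrite /tcoef qbin_small ?mulr0 //; lia. Qed.

Lemma qbin_step N n : (n <= N.+1)%N ->
  qbin N.+1.*2.+1 (N.+2 + n) =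
    (1 + 'X^(N.+1.*2)) * qbin N.*2.+1 (N.+1 + n)
    + 'X^(N.+1 - n) * qbin N.*2.+1 (N + n)
    + 'X^(N.+2 + n) * qbin N.*2.+1 (N.+2 + n).
Proof.
move=> le_nN; rewrite doubleS [(N.+2 + n)%N]addSn qbinS.
rewrite {1}addSn qbinS_sym; last by lia.
rewrite mulrDl mul1r !addSn.
have ->: (N.*2.+1 - (N + n) = N.+1 - n)%N by lia.
(* At [n = N.+1] the second mirror step is out of range, but the binomials involved vanish. *)
have [->|ltnN] : n = N.+1 \/ (n <= N)%N by lia.
  rewrite (@qbin_small N.*2.+2 (N + N.+1).+2); last by lia.
  rewrite (@qbin_small N.*2.+1 (N + N.+1).+2); last by lia.
  rewrite (@qbin_small N.*2.+1 (N + N.+1).+1); last by lia.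
  by ring.
rewrite [qbin _.+2 _.+2]qbinS_sym; last by lia.
have ->: 'X^(N.*2.+2) = 'X^((N + n).+2) * 'X^(N.*2.+1 - (N + n).+1) :> Zq.
  by rewrite -exprD; congr ('X^_); lia.
by ring.
Qed.

(** The neighbour at index -1 is [tcoef N 0] itself, because [qbin N.*2.+1] takes equal values at
    [N] and [N.+1]. *)
Lemma tcoefS0 N :
  tcoef N.+1 0 = (1 + 'X^(N.+1.*2)) * tcoef N 0
    + 'X^(N.+1) * (tcoef N 0 + tcoef N 1).
Proof.
rewrite /tcoef qbin_step // triS tri0 subn0 !addn0 !addn1.
have ->: N.*2.+1 = (N + N.+1)%N by lia.
by rewrite [qbin _ N]qbin_sym ['X^(N.+2)]exprS; ring.
Qed.

Lemma tcoefSS N n : (n <= N)%N ->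
  tcoef N.+1 n.+1 = (1 + 'X^(N.+1.*2)) * tcoef N n.+1
    + 'X^(N.+1) * (tcoef N n + tcoef N n.+2).
Proof.
move=> le_nN; rewrite /tcoef qbin_step // [tri n.+2]triS triS.
rewrite subSS !addnS !addSn.
have ->: 'X^(N.+1) = 'X^(N - n) * 'X^(n.+1) :> Zq.
  by rewrite -exprD; congr ('X^_); lia.
have ->: 'X^((N + n).+3) = 'X^(N - n) * 'X^(n.+1) * 'X^(n.+2) :> Zq.
  by rewrite -!exprD; congr ('X^_); lia.
have ->: 'X^((tri n + n).+1) = 'X^(tri n) * 'X^(n.+1) :> Zq.
  by rewrite -exprD addnS.
have ->: 'X^((tri n + n + n).+3) = 'X^(tri n) * 'X^(n.+1) * 'X^(n.+2) :> Zq.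
  by rewrite -!exprD; congr ('X^_); lia.
by ring.
Qed.

(** For [n >= 1], [z W_n = W_(n+1) + W_(n-1)], while [z W_0 = W_1 + 1] produces the isolated term
    [c 0]. *)
Lemma mulX_sum_altW (c : nat -> Zq) N :
  'X * \sum_(n < N.+1) (c n)%:P * altW n =
    (c 0%N)%:P + \sum_(n < N.+1) (c n)%:P * altW n.+1
    + \sum_(n < N) (c n.+1)%:P * altW n.
Proof.
elim: N => [|N IHN]; first by rewrite !big_ord_recr !big_ord0 /=; ring.
rewrite big_ord_recr mulrDr IHN [\sum_(n < N.+2) _]big_ord_recr.
by rewrite [\sum_(n < N.+1) (c n.+1)%:P * _]big_ord_recr altWSS /=; ring.
Qed.

(** The outer variable is [z]; [q] lives in the coefficients. A new factor acts on these by
    [tcoefS0] and [tcoefSS]. *)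
Lemma finite_triple_product N :
  \prod_(i < N) (1 + ('X^(i.+1))%:P * 'X + ('X^(i.+1.*2))%:P) =
    \sum_(n < N.+1) (tcoef N n)%:P * altW n.
Proof.
elim: N => [|N IHN].
  by rewrite big_ord0 big_ord1 /tcoef tri0 expr0 /= mulr0 addr0 !mulr1.
rewrite big_ord_recr IHN [LHS]/= [RHS]big_ord_recl [X in X + _]/= tcoefS0.
set c := tcoef N; set S := \sum_(n < N.+1) (c n)%:P * altW n.
have c0 n : (N < n)%N -> c n = 0 by exact: tcoef_small.
have S1 : S = (c 0%N)%:P + \sum_(n < N.+1) (c n.+1)%:P * altW n.+1.
  rewrite /S big_ord_recl mulr1; congr (_ + _); rewrite [RHS]big_ord_recr /=.
  by rewrite c0 // mul0r addr0.
have S2 : \sum_(n < N) (c n.+1)%:P * altW n =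
    (c 1%N)%:P + \sum_(n < N.+1) (c n.+2)%:P * altW n.+1.
  transitivity (\sum_(n < N.+2) (c n.+1)%:P * altW n).
    by rewrite !big_ord_recr /= (c0 N.+1) // (c0 N.+2) // !mul0r !addr0.
  by rewrite big_ord_recl mulr1.
transitivity ((1 + ('X^(N.+1.*2))%:P) * S + ('X^(N.+1))%:P * ('X * S)).
  by ring.
rewrite mulX_sum_altW S2 {1}S1.
have -> : \sum_(i < N.+1) (tcoef N.+1 (lift ord0 i))%:P * altW (lift ord0 i) =
    (1 + ('X^(N.+1.*2))%:P) * (\sum_(n < N.+1) (c n.+1)%:P * altW n.+1)
    + ('X^(N.+1))%:P * (\sum_(n < N.+1) (c n)%:P * altW n.+1)
    + ('X^(N.+1))%:P * (\sum_(n < N.+1) (c n.+2)%:P * altW n.+1).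
  rewrite !mulr_sumr -!big_split; apply: eq_bigr => i _.
  have le_iN : (i <= N)%N by rewrite -ltnS.
  rewrite lift0 (tcoefSS le_iN) -/c.
  by rewrite !(polyCD, polyCM) polyC1 /=; ring.
by rewrite !(polyCD, polyCM) polyC1 /=; ring.
Qed.

(** The binomial inverts [qfact N] only modulo [q^(N-n+1)], but the factor [q^(T_n)], with
    [n <= T_n], restores the full precision. *)
Lemma qfact_tcoef N n : (n <= N)%N ->
  eqmod 'X^(N.+1) (qfact N * tcoef N n) 'X^(tri n).
Proof.
move=> le_nN.
have [r qbr] : eqmod 'X^((N - n).+1) (qfact N * qbin N.*2.+1 (N.+1 + n)) 1.
  have le_N : (N - n <= N)%N by lia.
  apply: eqmod_trans (eqmodM (qfact_widen le_N) (eqmod_refl _ _)) _.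
  apply: (eqmodXn_cancel (qfact_unit (N - n))); rewrite mulr1.
  have := qbin_fact (N.+1 + n) (N - n).
  rewrite (_ : N.+1 + n + (N - n) = N.*2.+1)%N; last by lia.
  have le1 : (N - n <= N.*2.+1)%N by lia.
  have le2 : (N - n <= N.+1 + n)%N by lia.
  move=> qf; apply: eqmod_trans (qfact_widen le1); rewrite -qf.
  rewrite [X in eqmod _ _ X]mulrA [X in eqmod _ _ X]mulrC.
  apply: eqmodM; first exact: eqmod_refl.
  rewrite [X in eqmod _ _ X]mulrC; apply: eqmodM; last exact: eqmod_refl.
  exact/eqmod_sym/qfact_widen.
rewrite /tcoef mulrCA qbr mulrDr mulr1 mulrA -exprD; apply: eqmodXn_add.
have : (n <= tri n)%N by case: (n) => // k; rewrite triS leq_addl.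
by lia.
Qed.

(** * Coefficients of [z^2] *)

Lemma coef2_altW m :
  [/\ (altW m.*2)`_0 = (-1) ^+ m, (altW m.*2)`_1 = (-1) ^+ m *+ m
    & (altW m.*2)`_2 = - ((-1) ^+ m *+ tri m)] /\
  [/\ (altW m.*2.+1)`_0 = - (-1) ^+ m, (altW m.*2.+1)`_1 = (-1) ^+ m *+ m.+1
    & (altW m.*2.+1)`_2 = (-1) ^+ m *+ tri m].
Proof.
elim: m => [|m [[e0 e1 e2] [o0 o1 o2]]].
  by split; split; rewrite /= ?coefB ?coefX ?coef1 /= ?(subr0, sub0r, oppr0).
have [E0 E1 E2] : [/\ (altW m.+1.*2)`_0 = (-1) ^+ m.+1,
    (altW m.+1.*2)`_1 = (-1) ^+ m.+1 *+ m.+1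
    & (altW m.+1.*2)`_2 = - ((-1) ^+ m.+1 *+ tri m.+1)].
  rewrite doubleS altWSS !coefB !coefXM /= e0 e1 e2 o0 o1 triS exprS.
  rewrite !mulN1r !mulNrn mulrnDr mulrS; split; ring.
split=> //; rewrite doubleS altWSS -doubleS !coefB !coefXM /=.
rewrite E0 E1 o0 o1 o2 triS exprS.
rewrite !mulN1r !mulNrn !mulrnDr !mulrS; split; ring.
Qed.

(** The signs match because [T_(2m) = m (2m+1)] has the parity of [m], and [T_(2m+1) = (m+1) (2m+1)]
    that of [m+1]. *)
Lemma altW_coef2 r :
  (altW r.+2)`_2 = ((-1) ^+ tri r * (tri (uphalf r.+1))%:Z)%:P.
Proof.
have PC m k : ((-1) ^+ m * k%:Z)%:P = (-1) ^+ odd m *+ k :> Zq.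
  by rewrite rmorphM rmorphXn rmorphN1 -natz rmorph_nat mulr_natr signr_odd.
have tri_even m : tri m.*2 = (m * m.*2.+1)%N.
  by rewrite /tri -muln2 mulnAC mulnK // muln2.
have [[m ->]|[m ->]] : (exists m, r = m.*2) \/ (exists m, r = m.*2.+1).
  by have := odd_double_half r; case: (odd r) => <-; [right|left]; exists r./2.
- have [[_ _ We] _] := coef2_altW m.+1; rewrite -doubleS We PC.
  rewrite (_ : uphalf _ = m.+1); last by lia.
  rewrite tri_even oddM /= odd_double andbT signr_odd exprS mulN1r mulNrn.
  by rewrite opprK.
have [_ [_ _ Wo]] := coef2_altW m.+1; rewrite -doubleS Wo PC.
rewrite (_ : uphalf _ = m.+1); last by lia.
rewrite [tri m.*2.+1]triS tri_even oddD oddM /= !odd_double andbT addbT.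
by rewrite -signr_odd.
Qed.

Lemma coef2_prod1D (R : comNzRingType) (g : nat -> R) N :
  (\prod_(i < N) (1 + (g i)%:P * 'X))`_2 =
  \sum_(j < N) \sum_(i < N | (i < j)%N) g i * g j.
Proof.
have -> : \sum_(j < N) \sum_(i < N | (i < j)%N) g i * g j =
    \sum_(j < N) \sum_(i < j) g i * g j.
  apply: eq_bigr => j _.
  by rewrite -(big_ord_widen N (fun i => g i * g j)) // ltnW.
suff [] : [/\ (\prod_(i < N) (1 + (g i)%:P * 'X))`_0 = 1,
    (\prod_(i < N) (1 + (g i)%:P * 'X))`_1 = \sum_(i < N) g i &
    (\prod_(i < N) (1 + (g i)%:P * 'X))`_2 =
      \sum_(j < N) \sum_(i < j) g i * g j] by [].
elim: N => [|N [IH0 IH1 IH2]]; first by rewrite !big_ord0 !coef1.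
rewrite !big_ord_recr /= mulrDr mulr1 mulrA !coefD !coefMX /= !coefMC.
by rewrite IH0 IH1 IH2 addr0 mul1r -mulr_suml.
Qed.

(** * Generating functions of [asign] and [pod] *)

(* Truncation of [q^x / (1 + q^(2x))]. *)
Definition oddgeom N x : Zq := \sum_(r < N.+1) (-1) ^+ r * 'X^((2 * r + 1) * x).

Lemma oddgeom_eqmod N x : (0 < x)%N ->
  eqmod 'X^(N.+1) (oddgeom N x * (1 + 'X^(x.*2))) 'X^x.
Proof.
move=> x_gt0.
have -> : oddgeom N x = 'X^x * \sum_(r < N.+1) (- 'X^(x.*2)) ^+ r.
  rewrite mulr_sumr; apply: eq_bigr => r _.
  rewrite [(- 'X^_) ^+ r]exprNn -exprM mulrCA -exprD; congr (_ * 'X^_); lia.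
have := subrX1 (- 'X^(x.*2) : Zq) N.+1; set S := \sum_(i < _) _ => eS.
have -> : 'X^x * S * (1 + 'X^(x.*2)) =
    'X^x + 'X^(x + x.*2 * N.+1) * - (-1) ^+ N.+1 :> Zq.
  have -> : 'X^x * S * (1 + 'X^(x.*2)) = - 'X^x * ((- 'X^(x.*2) - 1) * S).
    by ring.
  by rewrite -eS [(- 'X^_) ^+ _]exprNn -exprM exprD; ring.
by apply: eqmodXn_add; nia.
Qed.

Lemma asign_coef n :
  asign n = (\sum_(j < n) \sum_(i < n | (i < j)%N)
               oddgeom n i.+1 * oddgeom n j.+1)`_n.
Proof.
(* The values [x = 0] and [y = 0] contribute nothing, so [i] and [j] stand for [x - 1] and
   [y - 1]. *)
rewrite /asign big_ord_recl [X in X + _]big1 ?add0r; last first.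
  move=> y _; by rewrite big1 // => r1 _; rewrite big1.
rewrite exchange_big coef_sum /=.
rewrite big_ord_recl [X in X + _]big1 ?add0r; last first.
  by move=> x _; rewrite big1 // => r1 _; rewrite big1.
apply: eq_bigr => j _; rewrite coef_sum [RHS]big_mkcond; apply: eq_bigr => i _.
rewrite !lift0 ltnS /=; case: ifP => lt_ij; last first.
  by rewrite big1 // => r1 _; rewrite big1.
rewrite /oddgeom mulr_suml coef_sum; apply: eq_bigr => r1 _.
rewrite mulr_sumr coef_sum big_mkcond; apply: eq_bigr => r2 _.
rewrite mulrACA -!exprD -[(-1 : Zq)]/(- (1%:P)) -polyCN -polyC_exp.
rewrite coefCM coefXn.
by rewrite eq_sym; case: eqP; rewrite ?mulr1 ?mulr0.
Qed.

Definition podp n : Zq :=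
  \prod_(i < n) \sum_(m < n.+1 | odd i.+1 ==> (m <= 1)%N) 'X^(m * i.+1).

Definition evenprod n : Zq := \prod_(i < n) (1 + 'X^(i.+1.*2)).

(** Expanding the product chooses one multiplicity per part, which is the encoding used by
    [pod_nat]. *)
Lemma coef_podp n : (podp n)`_n = (pod_nat n)%:Z.
Proof.
rewrite /podp bigA_distr_big_dep coef_sum.
under eq_bigr => f _ do rewrite prodrXr coefXn eq_sym.
rewrite -natr_sum natz -big_mkcondr sum1_card; congr (Posz _).
apply: eq_card => f; rewrite !inE /is_partition andbC; congr (_ && _).
Qed.

(* Euler's identity [prod_(i odd) (1 - Q^i) * prod_i (1 + Q^i) = 1] at
   [Q = q^2], with the truncation error kept on the right. *)
Lemma odd_euler n :
  \prod_(i < n) ((if odd i.+1 then 1 - 'X^(i.+1.*2) else 1)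
                   * (1 + 'X^(i.+1.*2)))
    * \prod_(i < n./2) (1 - 'X^(4 * i.+1))
  = \prod_(i < n) (1 - 'X^(4 * i.+1)) :> Zq.
Proof.
elim: n => [|n IHn]; first by rewrite !big_ord0 mulr1.
rewrite !big_ord_recr -IHn /= uphalf_half.
have e4 : 'X^(4 * n.+1) = 'X^(n.+1.*2) * 'X^(n.+1.*2) :> Zq.
  by rewrite -exprD; congr ('X^_); lia.
case: (boolP (odd n)) => odd_n /=; last by rewrite e4; ring.
rewrite add1n big_ord_recr /= [(4 * n./2.+1)%N](_ : _ = n.+1.*2); last by lia.
by rewrite e4; ring.
Qed.

(** An odd part gives [(1 + q^i) (1 - q^i) = 1 - q^(2i)], and for an even part [1 - q^i] cancels a
    truncated geometric series. The product left is that of [odd_euler]. *)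
Lemma podp_inv n : eqmod 'X^(n.+1) (podp n * (qfact n * evenprod n)) 1.
Proof.
rewrite /podp /qfact /evenprod -!big_split /=.
apply: (@eqmod_trans _ _ (\prod_(i < n)
    ((if odd i.+1 then 1 - 'X^(i.+1.*2) else 1) * (1 + 'X^(i.+1.*2))))).
  apply: eqmod_prod => i _; rewrite mulrA.
  apply: eqmodM; last exact: eqmod_refl.
  case: ifP => /= odd_i.
    rewrite (eq_bigl (fun m : 'I_n.+1 => (m < 2)%N)) => [|m]; last first.
      by rewrite odd_i ltnS.
    have -> : \sum_(m < n.+1 | (m < 2)%N) 'X^(m * i.+1) = 1 + 'X^(i.+1) :> Zq.
      rewrite -(big_ord_widen n.+1 (fun m => 'X^(m * i.+1) : Zq)).
        by rewrite !big_ord_recr big_ord0 /= add0r mul0n mul1n.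
      by rewrite ltnS; apply: leq_ltn_trans (ltn_ord i).
    rewrite [X in eqmod _ X](_ : _ = 1 - 'X^(i.+1.*2)); first exact: eqmod_refl.
    by rewrite -addnn exprD; ring.
  rewrite (eq_bigl xpredT) => [|m]; last by rewrite odd_i.
  have -> : (\sum_(m < n.+1) 'X^(m * i.+1)) * (1 - 'X^(i.+1)) =
      1 - 'X^(i.+1 * n.+1) :> Zq.
    rewrite exprM -[1 - 'X^(i.+1) ^+ _]opprB subrX1 mulrC -mulNr opprB.
    by congr (_ * _); apply: eq_bigr => m _; rewrite -exprM mulnC.
  by apply: eqmodXn_1sub; rewrite leq_pmull.
set H := \prod_(i < n) _.
have := odd_euler n; rewrite -/H => eH.
set P := \prod_(i < n./2) (1 - 'X^(4 * i.+1)) in eH.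
(* On the right of [eH] the factors beyond the first [n./2] have exponents above [n], so modulo
   [q^(n+1)] the identity reads [H * P = P]. *)
apply: (@eqmodXn_cancel _ P).
  have -> : 1 = \prod_(i < 0) (1 - 'X^(4 * i.+1)) :> Zq by rewrite big_ord0.
  apply: (eqmod_prod_widen (F := fun i => 1 - 'X^(4 * i.+1))) => // i _.
  exact: (@eqmodXn_1sub 1).
rewrite mulr1 mulrC eH.
apply: (eqmod_prod_widen (F := fun i => 1 - 'X^(4 * i.+1))); first by lia.
by move=> i ?; apply: eqmodXn_1sub; lia.
Qed.

(** Modulo [q^(k+1)], [podp n] and [podp k] invert the same product, hence agree. *)
Lemma podp_coef k n : (k <= n)%N -> (podp n)`_k = (pod_nat k)%:Z.
Proof.
move=> le_kn; rewrite -coef_podp.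
apply: (coef_eqmodXn (ltnSn k)).
have le_kn1 : (k.+1 <= n.+1)%N by [].
apply: (eqmod_inv_cancel (podp_inv k)).
apply: eqmod_trans (eqmod_sym _); last by rewrite mulrC; apply: podp_inv.
apply: eqmod_trans (eqmodXnW le_kn1 (podp_inv n)).
rewrite mulrC; apply: eqmodM; first exact: eqmod_refl.
apply/eqmod_sym/eqmodM; first exact: qfact_widen.
apply: (eqmod_prod_widen (F := fun i => 1 + 'X^(i.+1.*2))) => // i ki.
by rewrite -['X^(i.+1.*2)]mulr1; apply: eqmodXn_add; lia.
Qed.

(** Multiplying each [1 + z f x] by [1 + q^(2x)] gives a factor of the finite triple product;
    [qfact n * evenprod n] is then cancelled through its inverse [podp n]. *)
Lemma asign_coef_podp n :
  asign n = (podp n * \sum_(k < n.+1) 'X^(tri k) * (altW k)`_2)`_n.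
Proof.
rewrite asign_coef; apply: (coef_eqmodXn (ltnSn n)).
rewrite -(coef2_prod1D (fun i => oddgeom n i.+1)); set G := \prod_(i < n) _.
have prodE : eqmod 'X^(n.+1) (G`_2 * evenprod n)
    (\sum_(k < n.+1) tcoef n k * (altW k)`_2).
  have := finite_triple_product n; set T := \sum_(k < n.+1) _ => JTP.
  have -> : \sum_(k < n.+1) tcoef n k * (altW k)`_2 = T`_2.
    by rewrite coef_sum; apply: eq_bigr => k _; rewrite coefCM.
  rewrite -coefMC; apply: eqmod_coef; rewrite -JTP rmorph_prod -big_split /=.
  apply: eqmod_prod => i _.
  have [r er] := @oddgeom_eqmod n i.+1 isT; exists (r%:P * 'X).
  rewrite mulrDl mul1r mulrAC -polyCM er !(polyCD, polyCM) polyC1; ring.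
apply: (eqmod_inv_cancel (podp_inv n)).
apply: (@eqmod_trans _ _ (qfact n * \sum_(k < n.+1) tcoef n k * (altW k)`_2)).
  rewrite -mulrA; apply: eqmodM; first exact: eqmod_refl.
  by rewrite mulrC.
apply: (@eqmod_trans _ _ (\sum_(k < n.+1) 'X^(tri k) * (altW k)`_2)).
  rewrite mulr_sumr; apply: eqmod_sum => k _; rewrite mulrA.
  by apply: eqmodM; [apply: qfact_tcoef; rewrite -ltnS | apply: eqmod_refl].
set S := \sum_(k < n.+1) _; rewrite mulrA [_ * podp n]mulrC.
rewrite -[X in eqmod _ X]mul1r; apply: eqmodM; last exact: eqmod_refl.
exact/eqmod_sym/podp_inv.
Qed.

(** * From coefficients to the sum over [r] *)

Lemma pod_sub n t : (pod (n%:Z - t%:Z))%:Z = ('X^t * podp n)`_n.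
Proof.
rewrite coefXnM; case: ltnP => [lt_nt|le_tn].
  have [k ->] : exists k, t = (n + k.+1)%N by exists (t - n).-1; lia.
  by rewrite PoszD opprD addrA subrr add0r.
by rewrite subzn // podp_coef // leq_subr.
Qed.

Lemma asign_sum n :
  asign n = \sum_(r < n) (-1) ^+ tri r * (tri (uphalf r.+1))%:Z
              * (pod (n%:Z - (tri r.+2)%:Z))%:Z.
Proof.
rewrite asign_coef_podp mulr_sumr coef_sum.
(* The extra index [k = n.+1] adds nothing since [T_(n+1) > n]; dropping the zero terms at [k = 0]
   and [k = 1] then leaves [n] terms, with [k = r.+2]. *)
transitivity (\sum_(k < n.+2) (podp n * ('X^(tri k) * (altW k)`_2))`_n).
  rewrite [RHS]big_ord_recr /= mulrCA coefXnM ifT ?addr0 //.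
  by rewrite triS; lia.
rewrite !big_ord_recl.
have -> : (altW (ord0 : 'I_n.+2))`_2 = 0 by rewrite coef1.
have -> : (altW (lift ord0 (ord0 : 'I_n.+1)))`_2 = 0.
  by rewrite /= coefB coefX coef1 subrr.
rewrite !mulr0 !coef0 !add0r; apply: eq_bigr => r _.
by rewrite !lift0 altW_coef2 mulrA mulrC coefCM pod_sub [podp n * _]mulrC.
Qed.

(* \sum_(r \in A) is the sum over the support of the summand in A, which is
   finite here since pod vanishes on negative integers. *)
Theorem corollary1p4 (n : nat) (n_gt0 : (0 < n)%N) :
  asign n =
    \sum_(r \in [set r : nat | (1 <= r)%N]%classic)
      (-1) ^+ tri r.-1 * (tri (uphalf r))%:Z
        * (pod (n%:Z - (tri r.+1)%:Z))%:Z :> int.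
Proof.
rewrite asign_sum (fsbigE (index_iota 1 n.+1)) ?iota_uniq //=.
- rewrite big_add1 /= big_mkord.
  by apply: eq_bigl => r; rewrite mem_set.
- by move=> r /=; rewrite mem_index_iota => /andP[].
(* For [r > n], [T_(r+1)] exceeds [n], so the summand vanishes. *)
move=> r /= r_gt0; rewrite mem_index_iota r_gt0 /= -leqNgt => lt_nr.
rewrite pod_sub coefXnM ifT ?mulr0 //.
by rewrite triS; lia.
Qed.
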